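(* Let $(X,\phi)$ and $(Y,\psi)$ be irreducible Smale spaces with $X$ and $Y$ infinite, and suppose that they are stably continuous orbit equivalent. Let $h:X\to Y$ be a homeomorphism which (together with continuous functions $c_1,c_2$ and two-cocycles $d_1,d_2$) gives rise to a stably continuous orbit equivalence between them. Then $$\zeta_\phi(t)=\zeta_{\xi_{h^{-1}}}(t),\qquad \zeta_\psi(t)=\zeta_{\xi_h}(t).$$
   Context: Smale spaces. Let $\phi$ be a homeomorphism of a compact metric space $(X,d)$. For $\epsilon>0$ put $\Delta_\epsilon=\{(x,y)\in X\times X: d(x,y)<\epsilon\}$. $(X,\phi)$ is a Smale space if there are $\epsilon_0>0$, $0<\lambda_0<1$ and a continuous map $[\cdot,\cdot]:\Delta_{\epsilon_0}\to X$ such that: (SS1) $[x,x]=x$; $[[x,y],z]=[x,[y,z]]=[x,z]$ whenever $(x,y),(y,z),(x,z),([x,y],z),(x,[y,z])\in\Delta_{\epsilon_0}$; $[\phi(x),\phi(y)]=\phi([x,y])$ whenever $(x,y),(\phi(x),\phi(y))\in\Delta_{\epsilon_0}$; (SS2) with $X^s(x,\epsilon)=\{y: [y,x]=y,\ d(x,y)<\epsilon\}$ and $X^u(x,\epsilon)=\{y:[x,y]=y,\ d(x,y)<\epsilon\}$ for $0<\epsilon\le\epsilon_0$, one has $d(\phi(y),\phi(z))\le\lambda_0d(y,z)$ for $y,z\in X^s(x,\epsilon)$ and $d(\phi^{-1}(y),\phi^{-1}(z))\le\lambda_0d(y,z)$ for $y,z\in X^u(x,\epsilon)$. It is irreducible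 if for every ordered pair of (nonempty) open sets $U,V\subset X$ there is $K\in\mathbb{N}$ with $\phi^K(U)\cap V\ne\emptyset$. Stable equivalence. $G_\phi^{s,0}=\{(x,y): y\in X^s(x,\epsilon_0)\}$, $G_\phi^{s,n}=(\phi\times\phi)^{-n}(G_\phi^{s,0})$ for $n\ge0$ with the relative topology of $X\times X$, and $G_\phi^s=\bigcup_nG_\phi^{s,n}$ with the inductive limit topology; as a set $G_\phi^s=\{(x,y):\lim_{n\to\infty}d(\phi^n(x),\phi^n(y))=0\}$. For continuous $f:X\to\mathbb{Z}$ put $f^n(x)=\sum_{i=0}^{n-1}f(\phi^i(x))$ for $n>0$, $f^0=0$, $f^n(x)=-\sum_{i=n}^{-1}f(\phi^i(x))$ for $n<0$ (similarly on $Y$ with $\psi$). A two-cocycle on $G_\phi^s$ is a continuous $d:G_\phi^s\to\mathbb{Z}$ with $d(x,z)+d(z,w)=d(x,w)$. $\mathbb{Z}_+$ denotes the nonnegative integers. Stably continuous orbit equivalence: there exist a homeomorphism $h:X\to Y$, continuous $c_1:X\to\mathbb{Z}$, $c_2:Y\to\mathbb{Z}$ and two-cocycles $d_1:G_\phi^s\to\mathbb{Z}$, $d_2:G_\psi^s\to\mathbb{Z}$ such that (1) $c_1^m(x)+d_1(\phi^m(x),\phi^m(z))=c_1^m(z)+d_1(x,z)$ for $(x,z)\in G_\phi^s$, $m\in\mathbb{Z}$; (2) $c_2^m(y)+d_2(\psi^m(y),\psi^m(w))=c_2^m(w)+d_2(y,w)$ for $(y,w)\in G_\psi^s$, $m\in\mathbb{Z}$;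 (i) for each $n\in\mathbb{Z}$ there is a continuous $k_{1,n}:X\to\mathbb{Z}_+$ with $(\psi^{k_{1,n}(x)+c_1^n(x)}(h(x)),\psi^{k_{1,n}(x)}(h(\phi^n(x))))\in G_\psi^{s,0}$; (ii) for each $n\in\mathbb{Z}$ there is a continuous $k_{2,n}:Y\to\mathbb{Z}_+$ with $(\phi^{k_{2,n}(y)+c_2^n(y)}(h^{-1}(y)),\phi^{k_{2,n}(y)}(h^{-1}(\psi^n(y))))\in G_\phi^{s,0}$; (iii) there is a continuous $m_1:G_\phi^s\to\mathbb{Z}_+$ with $(\psi^{m_1(x,z)+d_1(x,z)}(h(x)),\psi^{m_1(x,z)}(h(z)))\in G_\psi^{s,0}$ for $(x,z)\in G_\phi^s$; (iv) there is a continuous $m_2:G_\psi^s\to\mathbb{Z}_+$ with $(\phi^{m_2(y,w)+d_2(y,w)}(h^{-1}(y)),\phi^{m_2(y,w)}(h^{-1}(w)))\in G_\phi^{s,0}$ for $(y,w)\in G_\psi^s$; (v) $c_2^{c_1^n(x)}(h(x))+d_2(\psi^{c_1^n(x)}(h(x)),h(\phi^n(x)))=n$ for $x\in X$, $n\in\mathbb{Z}$; (vi) $c_1^{c_2^n(y)}(h^{-1}(y))+d_1(\phi^{c_2^n(y)}(h^{-1}(y)),h^{-1}(\psi^n(y)))=n$ for $y\in Y$, $n\in\mathbb{Z}$; (vii) $c_2^{d_1(x,z)}(h(x))+d_2(\psi^{d_1(x,z)}(h(x)),h(z))=0$ for $(x,z)\in G_\phi^s$; (viii) $c_1^{d_2(y,w)}(h^{-1}(y))+d_1(\phi^{d_2(y,w)}(h^{-1}(y)),h^{-1}(w))=0$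 for $(y,w)\in G_\psi^s$. Zeta functions. $\operatorname{Per}_n(X)=\{x:\phi^n(x)=x\}$, which is finite, and $\zeta_\phi(t)=\exp\{\sum_{n\ge1}\frac{t^n}{n}|\operatorname{Per}_n(X)|\}$ (similarly $\zeta_\psi$). $\operatorname{P}_{\mathrm{orb}}(X)$ is the set of periodic orbits of $(X,\phi)$, and $|\gamma|$ is the cardinality (length) of a periodic orbit $\gamma$. For $x\in X$ with least period $p$ put $\eta_h(x)=\lim_{k\to\infty}\psi^{|c_1^p(x)|k}(h(x))$ (the limit exists and is a periodic point of $Y$), and for $\gamma=\{\phi^n(x):n\in\mathbb{Z}\}$ put $\xi_h(\gamma)=\{\psi^n(\eta_h(x)):n\in\mathbb{Z}\}$. The map $\xi_h:\operatorname{P}_{\mathrm{orb}}(X)\to\operatorname{P}_{\mathrm{orb}}(Y)$ is a bijection with $|\xi_h(\gamma)|=|c_1^{|\gamma|}(x)|$. Define $\zeta_{\xi_h}(t)=\prod_{\gamma\in\operatorname{P}_{\mathrm{orb}}(X)}(1-t^{|\xi_h(\gamma)|})^{-1}$. $\xi_{h^{-1}}:\operatorname{P}_{\mathrm{orb}}(Y)\to\operatorname{P}_{\mathrm{orb}}(X)$ and $\zeta_{\xi_{h^{-1}}}(t)=\prod_{\gamma\in\operatorname{P}_{\mathrm{orb}}(Y)}(1-t^{|\xi_{h^{-1}}(\gamma)|})^{-1}$ are defined symmetrically, with $h^{-1},c_2,\phi$ in place of $h,c_1,\psi$. *)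

(* Defs.v *)
From mathcomp Require Import all_boot all_order all_algebra finmap.
From mathcomp Require Import all_classical all_reals all_analysis.

Set Implicit Arguments.
Unset Strict Implicit.
Unset Printing Implicit Defensive.

Import Order.TTheory GRing.Theory Num.Theory.

Local Open Scope classical_set_scope.
Local Open Scope ring_scope.

Record homeomorphism (X Y : topologicalType) := Homeomorphism {
  homeo_fun :> X -> Y;
  homeo_inv : Y -> X;
  homeo_funK : cancel homeo_fun homeo_inv;
  homeo_invK : cancel homeo_inv homeo_fun;
  homeo_fun_continuous : continuous homeo_fun;
  homeo_inv_continuous : continuous homeo_inv
}.

Definition homeo_sym (X Y : topologicalType) (h : homeomorphism X Y) :
    homeomorphism Y X :=
  @Homeomorphism Y X (homeo_inv h) h (homeo_invK h) (homeo_funK h)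
    (@homeo_inv_continuous _ _ h) (@homeo_fun_continuous _ _ h).

(* phi ^ n for n : int; recall that Negz k is - k.+1 *)
Definition ziter (X : topologicalType) (phi : homeomorphism X X) (n : int) :
    X -> X :=
  match n with
  | Posz k => iter k phi
  | Negz k => iter k.+1 (homeo_inv phi)
  end.

Definition orb (X : topologicalType) (phi : homeomorphism X X) (x : X) :
    set X :=
  [set ziter phi n x | n in [set: int]].

(* Continuity of a map into a discrete space (Z or Z_+). *)
Definition dcontinuous (X : topologicalType) (D : Type) (f : X -> D) :=
  forall B : set D, open (f @^-1` B).

Section Smale.
Variables (R : realType).

Definition stable_set (X : metricType R) (br : X -> X -> X) (x : X) (e : R) :
    set X :=
  [set y | br y x = y /\ mdist x y < e].

Definition unstable_set (X : metricType R) (br : X -> X -> X) (x : X) (e : R) :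
    set X :=
  [set y | br x y = y /\ mdist x y < e].

(* The bracket is a total function, of which only the values on
   pairs at distance less than eps0 are constrained. *)
Record smaleSpace (X : metricType R) := SmaleSpace {
  smap :> homeomorphism X X;
  eps0 : R;
  lam0 : R;
  br : X -> X -> X;
  smale_compact : compact [set: X];
  eps0_gt0 : 0 < eps0;
  lam0_gt0 : 0 < lam0;
  lam0_lt1 : lam0 < 1;
  br_continuous :
    {within [set p : X * X | mdist p.1 p.2 < eps0],
      continuous (fun p : X * X => br p.1 p.2)};
  brxx : forall x, br x x = x;
  br_assoc : forall x y z,
    mdist x y < eps0 -> mdist y z < eps0 -> mdist x z < eps0 ->
    mdist (br x y) z < eps0 -> mdist x (br y z) < eps0 ->
    br (br x y) z = br x z /\ br x (br y z) = br x z;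
  br_smap : forall x y,
    mdist x y < eps0 -> mdist (smap x) (smap y) < eps0 ->
    br (smap x) (smap y) = smap (br x y);
  smap_contract : forall (e : R) (x y z : X), 0 < e -> e <= eps0 ->
    stable_set br x e y -> stable_set br x e z ->
    mdist (smap y) (smap z) <= lam0 * mdist y z;
  sinv_contract : forall (e : R) (x y z : X), 0 < e -> e <= eps0 ->
    unstable_set br x e y -> unstable_set br x e z ->
    mdist (homeo_inv smap y) (homeo_inv smap z) <= lam0 * mdist y z
}.

Definition irreducible (X : metricType R) (phi : homeomorphism X X) :=
  forall U V : set X, open U -> open V -> U !=set0 -> V !=set0 ->
  exists K : nat, (iter K phi @` U) `&` V !=set0.

Definition Gs0 (X : metricType R) (S : smaleSpace X) : set (X * X) :=
  [set p | stable_set (br S) p.1 (eps0 S) p.2].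

Definition Gsn (X : metricType R) (S : smaleSpace X) (n : nat) : set (X * X) :=
  [set p | Gs0 S (iter n S p.1, iter n S p.2)].

Definition Gs (X : metricType R) (S : smaleSpace X) : set (X * X) :=
  \bigcup_n Gsn S n.

(* The inductive limit topology on Gs S: a subset U of Gs S is open iff its
   trace on every Gsn S n is open for the topology induced by X * X. *)
Definition Gs_open (X : metricType R) (S : smaleSpace X) (U : set (X * X)) :=
  U `<=` Gs S /\
  forall n, exists2 O : set (X * X), open O & U `&` Gsn S n = O `&` Gsn S n.

(* Functions on Gs S are represented by functions on X * X, whose values
   outside Gs S are irrelevant. *)
Definition Gs_dcontinuous (X : metricType R) (S : smaleSpace X) (D : Type)
    (f : X * X -> D) :=
  forall B : set D, Gs_open S (Gs S `&` f @^-1` B).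

Definition two_cocycle (X : metricType R) (S : smaleSpace X)
    (d : X * X -> int) :=
  Gs_dcontinuous S d /\
  forall x z w, Gs S (x, z) -> Gs S (z, w) -> d (x, z) + d (z, w) = d (x, w).

(* csum phi f n x is f^n(x); for n = - k.+1 the indices n, ..., -1 of the sum
   are the Negz i with i <= k. *)
Definition csum (X : topologicalType) (phi : homeomorphism X X) (f : X -> int)
    (n : int) (x : X) : int :=
  match n with
  | Posz k => \sum_(i < k) f (ziter phi (Posz i) x)
  | Negz k => - \sum_(i < k.+1) f (ziter phi (Negz i) x)
  end.

(* The conditions of a stably continuous orbit equivalence come in pairs, the
   second of each pair being the first one for (h^-1, c2, c1, d2, d1). *)
Record half_stably_coe (X Y : metricType R) (SX : smaleSpace X)
    (SY : smaleSpace Y) (h : homeomorphism X Y) (c1 : X -> int) (c2 : Y -> int)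
    (d1 : X * X -> int) (d2 : Y * Y -> int) : Prop := HalfStablyCoe {
  coe_c_continuous : dcontinuous c1;
  coe_d_cocycle : two_cocycle SX d1;
  coe_cd : forall x z (m : int), Gs SX (x, z) ->
    csum SX c1 m x + d1 (ziter SX m x, ziter SX m z)
    = csum SX c1 m z + d1 (x, z);
  coe_orbit : forall n : int, exists2 k : X -> nat, dcontinuous k &
    forall x, Gs0 SY (ziter SY ((k x)%:Z + csum SX c1 n x) (h x),
                      ziter SY (k x)%:Z (h (ziter SX n x)));
  coe_stable : exists2 m : X * X -> nat, Gs_dcontinuous SX m &
    forall x z, Gs SX (x, z) ->
      Gs0 SY (ziter SY ((m (x, z))%:Z + d1 (x, z)) (h x),
              ziter SY (m (x, z))%:Z (h z));
  coe_c_inverse : forall x (n : int),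
    csum SY c2 (csum SX c1 n x) (h x)
    + d2 (ziter SY (csum SX c1 n x) (h x), h (ziter SX n x)) = n;
  coe_d_inverse : forall x z, Gs SX (x, z) ->
    csum SY c2 (d1 (x, z)) (h x) + d2 (ziter SY (d1 (x, z)) (h x), h z) = 0
}.

Definition stably_coe (X Y : metricType R) (SX : smaleSpace X)
    (SY : smaleSpace Y) (h : homeomorphism X Y) (c1 : X -> int) (c2 : Y -> int)
    (d1 : X * X -> int) (d2 : Y * Y -> int) : Prop :=
  half_stably_coe SX SY h c1 c2 d1 d2 /\
  half_stably_coe SY SX (homeo_sym h) c2 c1 d2 d1.

End Smale.

(* A formal power series in t over rat is the sequence of its coefficients. *)
Notation fps := (nat -> rat).

Definition fps_zero : fps := fun=> 0.
Definition fps_one : fps := fun n => (n == 0%N)%:R.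
Definition fps_X (l : nat) : fps := fun n => (n == l)%:R.
Definition fps_sub (F G : fps) : fps := fun n => F n - G n.
Definition fps_mul (F G : fps) : fps :=
  fun n => \sum_(i < n.+1) F i * G (n - i)%N.
Definition fps_pow (F : fps) (k : nat) : fps := iter k (fps_mul F) fps_one.
Definition fps_inv (F : fps) : fps :=
  xget fps_zero [set G : fps | fps_mul F G = fps_one].

(* \sum_k F^k / k!, for F without constant term: the terms with k > n do not
   contribute to the coefficient of t^n. *)
Definition fps_exp (F : fps) : fps :=
  fun n => \sum_(k < n.+1) fps_pow F k n / k`!%:R.

(* The unordered product of the F i, i in S, is G: every coefficient of the
   finite subproducts is eventually that of G. *)
Definition fps_has_prod (I : choiceType) (S : set I) (F : I -> fps) (G : fps) :=
  forall n : nat, exists2 A : {fset I}, [set` A] `<=` S &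
  forall B : {fset I}, [set` A] `<=` [set` B] -> [set` B] `<=` S ->
    (\big[fps_mul/fps_one]_(i <- B) F i) n = G n.

(* fps_zero if the product does not converge. *)
Definition fps_prod (I : choiceType) (S : set I) (F : I -> fps) : fps :=
  xget fps_zero [set G : fps | fps_has_prod S F G].

(* Cardinality of a finite set (0 for an infinite one). *)
Definition set_card (T : choiceType) (A : set T) : nat := #|` fset_set A|%fset.

Section Zeta.
Variables (R : realType).

Definition Per (X : metricType R) (phi : homeomorphism X X) (n : nat) : set X :=
  [set x | iter n phi x = x].

Definition zeta (X : metricType R) (phi : homeomorphism X X) : fps :=
  fps_exp (fun n => if n == 0%N then 0 else (set_card (Per phi n))%:R / n%:R).

Definition Porb (X : metricType R) (phi : homeomorphism X X) : set (set X) :=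
  [set g | exists x : X, exists2 n : nat, (0 < n)%N & Per phi n x /\ g = orb phi x].

Definition is_least_period (X : metricType R) (phi : homeomorphism X X) (x : X)
    (p : nat) :=
  [/\ (0 < p)%N, Per phi p x &
      forall q, (0 < q)%N -> Per phi q x -> (p <= q)%N].

Definition least_period (X : metricType R) (phi : homeomorphism X X) (x : X) :
    nat :=
  xget 0%N [set p | is_least_period phi x p].

(* xget (h x) picks the limit of the sequence (its default value h x is used
   only if there is no limit). *)
Definition eta (X Y : metricType R) (phi : homeomorphism X X)
    (psi : homeomorphism Y Y) (h : homeomorphism X Y) (c : X -> int) (x : X) :
    Y :=
  xget (h x) [set y : Y |
    (fun k : nat =>
       iter (`|csum phi c (least_period phi x)%:Z x| * k)%N psi (h x))
      @ \oo --> y].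

(* The psi-orbit of eta x for x in g; it does not depend on x, so that xi g is
   taken to be the union of these orbits. *)
Definition xi (X Y : metricType R) (phi : homeomorphism X X)
    (psi : homeomorphism Y Y) (h : homeomorphism X Y) (c : X -> int)
    (g : set X) : set Y :=
  \bigcup_(x in g) orb psi (eta phi psi h c x).

Definition zeta_xi (X Y : metricType R) (phi : homeomorphism X X)
    (psi : homeomorphism Y Y) (h : homeomorphism X Y) (c : X -> int) : fps :=
  fps_prod (Porb phi) (fun g : set X =>
    fps_inv (fps_sub fps_one (fps_X (set_card (xi phi psi h c g))))).

End Zeta.

(* Main.v *)
Require Import Defs.
From mathcomp Require Import all_boot all_order all_algebra finmap.
From mathcomp Require Import all_classical all_reals all_analysis.
From mathcomp Require Import ring lra zify.

(* [xi h] and [xi h^-1] are mutually inverse.  For a periodic point x, the point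
   h x is asymptotic to the periodic point eta x; condition (iv) transports this
   to X, so h^-1 (eta x) is asymptotic to a point of the orbit of x as well as to
   eta' (eta x), and asymptotic periodic points are equal.  The lengths
   |xi_{h^-1} g| therefore run over the lengths of the periodic orbits of X, each
   orbit counted once, and the claim becomes the Euler product of zeta_phi.  That
   product holds because both sides have constant term 1 and, for the derivation
   t d/dt, the same logarithmic derivative sum_n |Per_n| t^n; Per_n is finite
   since points staying close for all positive times are stably equivalent. *)

Set Implicit Arguments.
Unset Strict Implicit.
Unset Printing Implicit Defensive.

Import Order.TTheory GRing.Theory Num.Theory.

Local Open Scope classical_set_scope.
Local Open Scope ring_scope.

(** * Formal power series *)

Definition fps_add (F G : fps) : fps := fun n => F n + G n.
Definition fps_scale (a : rat) (F : fps) : fps := fun n => a * F n.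
(* t d/dt *)
Definition fps_theta (F : fps) : fps := fun n => n%:R * F n.

(** The coefficient at [n] only sees coefficients up to [n], so series may be truncated;
    commutativity and associativity are inherited from polynomials in this way. *)
Lemma fps_mul_poly (N : nat) (F G : fps) n : (n < N)%N ->
  fps_mul F G n = ((\poly_(i < N) F i) * (\poly_(i < N) G i))`_n.
Proof.
move=> nN; rewrite coefM; apply: eq_bigr => i _; rewrite !coef_poly.
have iN : (i < N)%N by exact: leq_trans (ltn_ord i) nN.
by rewrite iN (leq_ltn_trans (leq_subr _ _) nN).
Qed.

Lemma fps_mulC F G : fps_mul F G = fps_mul G F.
Proof. by apply/funext => n; rewrite !(@fps_mul_poly n.+1) // mulrC. Qed.

Lemma fps_mulA F G H : fps_mul F (fps_mul G H) = fps_mul (fps_mul F G) H.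
Proof.
have polyM (P Q : fps) n i : (i <= n)%N -> (\poly_(j < n.+1) fps_mul P Q j)`_i =
    ((\poly_(j < n.+1) P j) * (\poly_(j < n.+1) Q j))`_i.
  by move=> le_in; rewrite coef_poly ltnS le_in (@fps_mul_poly n.+1).
apply/funext => n; rewrite !(@fps_mul_poly n.+1) //.
transitivity (((\poly_(i < n.+1) F i) *
    ((\poly_(i < n.+1) G i) * (\poly_(i < n.+1) H i)))`_n).
  by rewrite !(coefM _ _ n); apply: eq_bigr => i _; rewrite polyM ?leq_subr.
rewrite mulrA !(coefM _ _ n); apply: eq_bigr => i _.
by rewrite polyM // -ltnS.
Qed.

Lemma fps_mul1 F : fps_mul fps_one F = F.
Proof.
apply/funext => n; rewrite /fps_mul big_ord_recl /= subn0 mul1r.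
by rewrite big1 ?addr0 // => i _; rewrite mul0r.
Qed.

Lemma fps_mulDl F G H :
  fps_mul (fps_add F G) H = fps_add (fps_mul F H) (fps_mul G H).
Proof.
apply/funext => n; rewrite /fps_add /fps_mul -big_split /=.
by apply: eq_bigr => i _; rewrite mulrDl.
Qed.

Lemma fps_scaleAl a F G : fps_mul (fps_scale a F) G = fps_scale a (fps_mul F G).
Proof.
apply/funext => n; rewrite /fps_scale /fps_mul big_distrr /=.
by apply: eq_bigr => i _; rewrite mulrA.
Qed.

Lemma fps_thetaM F G : fps_theta (fps_mul F G) =
  fps_add (fps_mul (fps_theta F) G) (fps_mul F (fps_theta G)).
Proof.
apply/funext => n; rewrite /fps_theta /fps_add /fps_mul big_distrr -big_split /=.
apply: eq_bigr => i _.
have -> : n%:R = i%:R + (n - i)%:R :> rat by rewrite -natrD subnKC // -ltnS.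
by ring.
Qed.

Lemma fps_thetaX F k : fps_theta (fps_pow F k.+1) =
  fps_scale k.+1%:R (fps_mul (fps_theta F) (fps_pow F k)).
Proof.
elim: k => [|k IH].
  rewrite /= (fps_mulC F) fps_mul1 (fps_mulC _ fps_one) fps_mul1.
  by apply/funext => n; rewrite /fps_scale mul1r.
have -> : fps_pow F k.+2 = fps_mul F (fps_pow F k.+1) by [].
rewrite fps_thetaM IH (fps_mulC F) fps_scaleAl -fps_mulA (fps_mulC _ F).
apply/funext => n; rewrite /fps_add /fps_scale -[k.+2]addn1 natrD mulrDl mul1r.
by rewrite addrC.
Qed.

Lemma fps_pow_small F k n : F 0%N = 0 -> (n < k)%N -> fps_pow F k n = 0.
Proof.
move=> F0; elim: k n => // k IH n nk; rewrite /= /fps_mul.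
apply: big1 => -[[|i] ilt] _ /=; first by rewrite F0 mul0r.
by rewrite IH ?mulr0 //; lia.
Qed.

(** Termwise, [fps_theta] turns F^(k+1)/(k+1)! into (theta F) F^k/k!, and it kills the constant term
    k = 0. *)
Lemma fps_theta_exp F : F 0%N = 0 ->
  fps_theta (fps_exp F) = fps_mul (fps_theta F) (fps_exp F).
Proof.
move=> F0; apply/funext => n.
rewrite /fps_theta {1}/fps_exp big_distrr /= big_ord_recl /=.
have -> : n%:R * (fps_one n / 0`!%:R) = 0 :> rat.
  by case: n => [|n]; rewrite /fps_one /= ?mul0r ?mulr0.
rewrite add0r.
under eq_bigr => k _.
  rewrite mulrA -[n%:R * _]/(fps_theta (fps_pow F k.+1) n) fps_thetaX.
  rewrite /fps_scale factS natrM invfM mulrACA divff ?pnatr_eq0 // mul1r.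
  rewrite /fps_mul big_distrl /=.
  over.
rewrite exchange_big /=; apply: eq_bigr => -[[|i] ilt] _ /=.
  rewrite /fps_theta !mul0r big1 // => k _; by rewrite !mul0r.
under eq_bigr do rewrite -mulrA.
rewrite -big_distrr /=; congr (_ * _); rewrite /fps_exp.
(* The two exponentials are truncated at different orders; the extra terms vanish because [F] has no
   constant term. *)
rewrite /= [RHS](big_ord_widen n (fun k => fps_pow F k (n - i.+1) / k`!%:R)); last lia.
rewrite [RHS]big_mkcond; apply: eq_bigr => k _.
by case: ifPn => //; rewrite -leqNgt => ?; rewrite fps_pow_small ?mul0r.
Qed.

(** The equation theta H = L H reads n H_n = sum of L_i H_(n-i). Since L_0 = 0, this is a recursion
    determining H_n from lower coefficients, up to the initial value H_0. *)
Lemma fps_theta_eq (L H H' : fps) (n : nat) : L 0%N = 0 ->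
  fps_theta H = fps_mul L H -> forall L' : fps,
  fps_theta H' = fps_mul L' H' -> (forall i, (i <= n)%N -> L i = L' i) ->
  H 0%N = H' 0%N -> H n = H' n.
Proof.
move=> L0 HL L' HL' LL' H0.
suff: forall m, (m <= n)%N -> H m = H' m by apply.
elim/ltn_ind => -[|m] IH mn //.
apply: (@mulfI _ m.+1%:R); first by rewrite pnatr_eq0.
rewrite -[LHS]/(fps_theta H m.+1) -[RHS]/(fps_theta H' m.+1) HL HL'.
rewrite /fps_mul; apply: eq_bigr => -[i /= ilt] _.
rewrite -(LL' i); last lia.
by case: i ilt => [|i] ilt; rewrite ?L0 ?mul0r // IH //; lia.
Qed.

(** The expansion of 1 / (1 - t^l) for positive [l]. *)
Definition fps_geom (l : nat) : fps := fun n => (l %| n)%:R.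

Lemma fps_mul_XE l F n :
  fps_mul (fps_X l) F n = if (l <= n)%N then F (n - l)%N else 0.
Proof.
rewrite /fps_mul /fps_X; case: leqP => ln; last first.
  by apply: big1 => -[i /= ilt] _; case: eqP => [?|]; [lia|rewrite mul0r].
rewrite (bigD1 (Ordinal (ln : (l < n.+1)%N))) //= eqxx mul1r big1 ?addr0 // => i.
by rewrite -val_eqE /= => /negbTE ->; rewrite mul0r.
Qed.

Lemma fps_mul_geom l : (0 < l)%N ->
  fps_mul (fps_sub fps_one (fps_X l)) (fps_geom l) = fps_one.
Proof.
move=> l0.
have -> : fps_sub fps_one (fps_X l) = fps_add fps_one (fps_scale (-1) (fps_X l)).
  by apply/funext => n; rewrite /fps_sub /fps_add /fps_scale mulN1r.
rewrite fps_mulDl fps_mul1 fps_scaleAl; apply/funext => n.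
rewrite /fps_add /fps_scale fps_mul_XE mulN1r /fps_geom /fps_one.
case: leqP => ln.
  rewrite dvdn_subl // subrr; case: n ln => //; lia.
rewrite oppr0 addr0; case: n ln => [|n] ln; first by rewrite dvdn0.
by rewrite gtnNdvd.
Qed.

Lemma fps_invE F G : fps_mul F G = fps_one -> fps_inv F = G.
Proof.
move=> FG; apply: xget_unique => // H FH.
by rewrite -(fps_mul1 H) -FG (fps_mulC F) -fps_mulA FH fps_mulC fps_mul1.
Qed.

Lemma fps_inv_geom l : (0 < l)%N -> fps_inv (fps_sub fps_one (fps_X l)) = fps_geom l.
Proof. by move=> l0; apply: fps_invE; exact: fps_mul_geom. Qed.

(* The logarithmic derivative of 1 / (1 - t^l). *)
Definition fps_dlog_geom (l : nat) : fps :=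
  fun n => if n == 0%N then 0 else (l * (l %| n))%:R.

Lemma fps_theta_geom l : (0 < l)%N ->
  fps_theta (fps_geom l) = fps_mul (fps_dlog_geom l) (fps_geom l).
Proof.
move=> l0.
(* It suffices that (1 - t^l) theta(1/(1 - t^l)) is l t^l/(1 - t^l); multiplying by the geometric
   series recovers the claim. *)
suff E : fps_mul (fps_sub fps_one (fps_X l)) (fps_theta (fps_geom l))
    = fps_dlog_geom l.
  by rewrite -E -fps_mulA (fps_mulC (fps_theta _)) fps_mulA fps_mul_geom // fps_mul1.
have -> : fps_sub fps_one (fps_X l) = fps_add fps_one (fps_scale (-1) (fps_X l)).
  by apply/funext => n; rewrite /fps_sub /fps_add /fps_scale mulN1r.
rewrite fps_mulDl fps_mul1 fps_scaleAl; apply/funext => n.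
rewrite /fps_add /fps_scale fps_mul_XE mulN1r /fps_theta /fps_geom /fps_dlog_geom.
case: leqP => ln.
  rewrite dvdn_subl // natrB // natrM; case: eqP => [|_]; first lia.
  by ring.
rewrite oppr0 addr0; case: n ln => [|n] ln; first by rewrite mul0r.
by rewrite gtnNdvd //= muln0 mulr0.
Qed.

Lemma fps_theta_prod (I : eqType) (s : seq I) (F L : I -> fps) :
  (forall i, i \in s -> fps_theta (F i) = fps_mul (L i) (F i)) ->
  fps_theta (\big[fps_mul/fps_one]_(i <- s) F i) =
  fps_mul (fun n => \sum_(i <- s) L i n) (\big[fps_mul/fps_one]_(i <- s) F i).
Proof.
elim: s => [_|a s IH FL].
  apply/funext => n; rewrite !big_nil /fps_mul big1 => [|i _]; last first.
    by rewrite big_nil mul0r.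
  by case: n => [|n]; rewrite /fps_theta ?mul0r ?mulr0.
rewrite big_cons fps_thetaM FL ?mem_head // IH; last first.
  by move=> i si; apply: FL; rewrite in_cons si orbT.
have -> : (fun n => \sum_(i <- a :: s) L i n) =
    fps_add (L a) (fun n => \sum_(i <- s) L i n).
  by apply/funext => n; rewrite big_cons.
rewrite fps_mulDl; congr fps_add; first by rewrite fps_mulA.
by rewrite !fps_mulA (fps_mulC (F a)).
Qed.

Lemma fps_prod0 (I : Type) (s : seq I) (F : I -> fps) :
  (\big[fps_mul/fps_one]_(i <- s) F i) 0%N = \prod_(i <- s) F i 0%N.
Proof.
elim: s => [|a s IH]; first by rewrite !big_nil.
by rewrite !big_cons /fps_mul big_ord_recl big_ord0 addr0 subnn IH.
Qed.

(** An unordered product is unique: two candidate limits are compared, at each coefficient, on the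
    union of their finite index sets. *)
Lemma fps_prodE (I : choiceType) (S : set I) (F : I -> fps) (G : fps) :
  fps_has_prod S F G -> fps_prod S F = G.
Proof.
move=> FG; apply: xget_unique => // H FH; apply/funext => n.
have [A AS HA] := FH n; have [B BS HB] := FG n.
have ABS : [set` (A `|` B)%fset] `<=` S.
  by move=> x /=; rewrite in_fsetU => /orP[/AS|/BS].
rewrite -(HA (A `|` B)%fset) // ?(HB (A `|` B)%fset) //.
- by move=> x /= xB; rewrite in_fsetU xB orbT.
- by move=> x /= xA; rewrite in_fsetU xA.
Qed.

(** * Periodic orbits and the Euler product *)

Section Orbits.
Variables (X : topologicalType) (phi : homeomorphism X X).

Lemma ziterS (m : int) (x : X) : ziter phi (m + 1) x = phi (ziter phi m x).
Proof.
case: m => [k|[|k]]; first by rewrite /= addn1.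
  by rewrite /= homeo_invK.
have -> : Negz k.+1 + 1 = Negz k by lia.
by rewrite /= homeo_invK.
Qed.

Lemma ziterB1 (m : int) (x : X) :
  ziter phi (m - 1) x = homeo_inv phi (ziter phi m x).
Proof. by rewrite -{2}(subrK 1 m) ziterS homeo_funK. Qed.

Lemma ziterD (m n : int) (x : X) :
  ziter phi (m + n) x = ziter phi m (ziter phi n x).
Proof.
case: m => k.
  elim: k => [|k IH]; first by rewrite add0r.
  by rewrite -addn1 PoszD addrAC !ziterS IH.
elim: k => [|k IH]; first by rewrite NegzE addrC ziterB1.
have -> : Negz k.+1 + n = Negz k + n - 1 by lia.
by rewrite ziterB1 IH.
Qed.

Lemma orb_refl (x : X) : orb phi x x.
Proof. by exists 0. Qed.

Lemma orb_eq (x y : X) : orb phi x y -> orb phi y = orb phi x.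
Proof.
move=> [m _ <-]; apply/seteqP; split=> [_ [n _ <-]|_ [n _ <-]].
  by exists (n + m) => //; rewrite ziterD.
by exists (n - m) => //; rewrite -ziterD subrK.
Qed.

End Orbits.

Lemma set_card_uniq (T : choiceType) (s : seq T) :
  uniq s -> set_card [set` s] = size s.
Proof.
move=> us; apply/perm_size/uniq_perm => // x; rewrite in_fset_set; last first.
  exact: finite_seq.
by apply/idP/idP; rewrite inE.
Qed.

Lemma set_cardI_sum (T : choiceType) (P A : set T) : finite_set P ->
  (\sum_(x <- fset_set P) (x \in A))%N = set_card (P `&` A).
Proof.
move=> finP; rewrite -big_mkcond /= sum1_count -size_filter.
apply/perm_size/uniq_perm => //; first by rewrite filter_uniq.
move=> x; rewrite mem_filter !in_fset_set //; last exact: finite_setIl.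
by rewrite in_setI andbC.
Qed.

Section PeriodicOrbits.
Variables (R : realType) (X : metricType R) (phi : homeomorphism X X).

Lemma Per_mul (p k : nat) (x : X) : Per phi p x -> Per phi (k * p)%N x.
Proof. by rewrite /Per /= => px; elim: k => // k IH; rewrite mulSn iterD IH. Qed.

Lemma Per_ziter (p : nat) (n : int) (x : X) :
  Per phi p x -> Per phi p (ziter phi n x).
Proof.
rewrite /Per /= => px.
rewrite -[LHS]/(ziter phi p%:Z (ziter phi n x)) -ziterD addrC ziterD.
by rewrite [ziter phi p x]px.
Qed.

Lemma Per_orb (p : nat) (x y : X) : Per phi p x -> orb phi x y -> Per phi p y.
Proof. by move=> px [n _ <-]; exact: Per_ziter. Qed.

Lemma least_periodP (n : nat) (x : X) : (0 < n)%N -> Per phi n x ->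
  is_least_period phi x (least_period phi x).
Proof.
move=> n0 xn; have ex : exists n, (0 < n)%N && (iter n phi x == x).
  by exists n; rewrite n0; exact/eqP.
have lp : is_least_period phi x (ex_minn ex).
  case: ex_minnP => p /andP[p0 /eqP px] pmin; split=> // q q0 /eqP xq.
  by apply: pmin; rewrite q0.
exact: (@xgetPex _ 0%N [set p | is_least_period phi x p] (ex_intro _ _ lp)).
Qed.

Lemma Per_dvdn (p n : nat) (x : X) : is_least_period phi x p ->
  Per phi n x <-> (p %| n)%N.
Proof.
move=> [p0 px pmin]; split=> [xn|/dvdnP[k ->]]; last exact: Per_mul.
(* A nonzero remainder of [n] modulo [p] would be a period shorter than [p]. *)
rewrite /dvdn; have := ltn_pmod n p0; case: posnP => // r0.
rewrite ltnNge => /negP; case; apply: pmin => //.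
by move: xn; rewrite /Per /= {1}(divn_eq n p) addnC iterD (Per_mul _ px).
Qed.

Lemma orb_iter (p : nat) (x : X) : is_least_period phi x p ->
  orb phi x = [set` [seq iter i phi x | i <- iota 0 p]].
Proof.
move=> [p0 px pmin]; apply/seteqP; split=> [_ [n _ <-]|_ /= /mapP[i _ ->]]; last first.
  by exists i%:Z.
apply/mapP; exists `|(n %% p)%Z|%N.
  by rewrite mem_iota /= add0n; have := @ltz_pmod n p p0; have := @modz_ge0 n p; lia.
have pn k : ziter phi (k * p%:Z) x = x.
  case: k => k; first by rewrite -PoszM; exact: Per_mul.
  have := Per_mul k.+1 px; rewrite /Per /= => E.
  rewrite -{1}E -[iter _ _ _]/(ziter phi (k.+1 * p)%N%:Z x) -ziterD.
  by have -> : Negz k * p + (k.+1 * p)%N = 0 by lia.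
rewrite {1}(divz_eq n p) addrC ziterD pn.
by rewrite -[RHS]/(ziter phi `|(n %% p)%Z|%N%:Z x) gez0_abs // modz_ge0; lia.
Qed.

Lemma card_orb (p : nat) (x : X) : is_least_period phi x p ->
  finite_set (orb phi x) /\ set_card (orb phi x) = p.
Proof.
move=> xp; rewrite (orb_iter xp); split; first exact: finite_seq.
case: xp => p0 px pmin.
rewrite set_card_uniq ?size_map ?size_iota //.
rewrite map_inj_in_uniq ?iota_uniq // => i j; rewrite !mem_iota /= !add0n.
wlog ij : i j / (i <= j)%N => [hw ip jp E|ip jp E].
  by case: (leqP i j) => [|/ltnW] ij; [exact: hw|apply/esym/hw].
apply/eqP; rewrite eqn_leq ij /= leqNgt; apply/negP => lij.
suff /pmin : Per phi (j - i) x by rewrite subn_gt0 => /(_ lij); lia.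
rewrite /Per /= -[LHS]/(ziter phi (j - i)%N%:Z x).
have -> : (j - i)%N%:Z = - i%:Z + j%:Z by lia.
rewrite ziterD -[ziter phi j _]/(iter j phi x) -E.
by rewrite -[iter i _ _]/(ziter phi i%:Z x) -ziterD addNr.
Qed.

Lemma Porb_orb (g : set X) (x : X) : Porb phi g -> g x -> g = orb phi x.
Proof. by move=> [y [n n0 [yn ->]]] /orb_eq. Qed.

Lemma Porb_Per (g : set X) (x : X) : Porb phi g -> g x ->
  exists2 n, (0 < n)%N & Per phi n x.
Proof. by move=> [y [n n0 [yn ->]]] yx; exists n => //; exact: Per_orb yx. Qed.

Lemma orb_Porb (n : nat) (x : X) : (0 < n)%N -> Per phi n x ->
  Porb phi (orb phi x).
Proof. by move=> n0 xn; exists x; exists n. Qed.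

Lemma Porb_card (g : set X) (x : X) : Porb phi g -> g x ->
  finite_set g /\ is_least_period phi x (set_card g).
Proof.
move=> gP gx; have [n n0 xn] := Porb_Per gP gx.
have xp := least_periodP n0 xn.
by rewrite (Porb_orb gP gx); have [? ->] := card_orb xp.
Qed.

Lemma Porb_card_gt0 (g : set X) : Porb phi g -> (0 < set_card g)%N.
Proof.
move=> gP; have [x [n _ [_ E]]] := gP.
have gx : g x by rewrite E; exact: orb_refl.
by have [_ []] := Porb_card gP gx.
Qed.

Lemma Porb_disjoint (g g' : set X) (x : X) :
  Porb phi g -> Porb phi g' -> g x -> g' x -> g = g'.
Proof. by move=> gP gP' gx gx'; rewrite (Porb_orb gP gx) (Porb_orb gP' gx'). Qed.

Lemma card_Per_Porb (n : nat) (g : set X) : finite_set (Per phi n) ->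
  Porb phi g ->
  set_card (Per phi n `&` g) = (set_card g * (set_card g %| n))%N.
Proof.
move=> finn gP; case: (boolP (_ %| _)%N) => [dv|ndv].
  rewrite muln1; congr set_card; apply/seteqP; split=> [x []//|x gx].
  by split=> //; apply/(Per_dvdn _ (Porb_card gP gx).2).
rewrite muln0; have -> : Per phi n `&` g = set0.
  rewrite -subset0 => x [xn gx]; have [_ xp] := Porb_card gP gx.
  by move/negP: ndv; apply; apply/(Per_dvdn _ xp).
by rewrite /set_card fset_set0 cardfs0.
Qed.

(** * The Euler product of the zeta function *)

Section EulerProduct.
(** The index set is kept abstract because the product in [zeta_xi] runs over the orbits of one
    system and uses the lengths of the orbits of the other. *)
Variables (I : choiceType) (S : set I) (f : I -> set X).
Hypotheses (f_bij : set_bij S (Porb phi) f)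
  (finPer : forall n, (0 < n)%N -> finite_set (Per phi n)).

(** These orbits all pass through the finite set of points with some period from 1 to [n], and
    injectivity of [f] carries finiteness back to the indices. *)
Lemma finite_short_orbits (n : nat) :
  finite_set [set i | S i /\ (set_card (f i) <= n)%N].
Proof.
case: f_bij => fP finj _.
have finU : finite_set (\bigcup_(k in `I_n) Per phi k.+1).
  by apply: bigcup_finite => [|k _]; [exact: finite_II|exact: finPer].
have : finite_set [set f i | i in [set i | S i /\ (set_card (f i) <= n)%N]].
  apply: sub_finite_set (finite_image (orb phi) finU) => _ [i [Si cn] <-].
  have fiP := fP _ Si.
  have [x [m _ [_ E]]] := fiP.
  have fx : f i x by rewrite E; exact: orb_refl.
  exists x => //; have [_ [p0 px _]] := Porb_card fiP fx.
  exists (set_card (f i)).-1; rewrite /= ?prednK //.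
rewrite (eq_finite_set (inj_card_eq _)) // => i j.
by rewrite !inE => -[Si _] [Sj _]; apply: finj; rewrite inE.
Qed.

(** Double counting of the pairs (i, x) with [x] in [Per phi m] and in [f i]. The orbit of such an
    [x] has length dividing [m], so its index lies in [B]; by disjointness of orbits no other index
    counts [x]. *)
Lemma card_Per_sum (n m : nat) (B : {fset I}) : (0 < m <= n)%N ->
  [set i | S i /\ (set_card (f i) <= n)%N] `<=` [set` B] -> [set` B] `<=` S ->
  set_card (Per phi m) =
    (\sum_(i <- B) set_card (f i) * (set_card (f i) %| m))%N.
Proof.
case: f_bij => fP finj fsurj /andP[m0 mn] AB BS.
have finm := finPer m0.
have fB i : i \in B -> Porb phi (f i) by move=> iB; exact/fP/BS.
transitivity (\sum_(i <- B) \sum_(x <- fset_set (Per phi m)) (x \in f i))%N; last first.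
  apply: eq_big_seq => i iB; rewrite set_cardI_sum // card_Per_Porb //; exact: fB.
rewrite exchange_big /= /set_card -sum1_size; apply: eq_big_seq => x.
rewrite in_fset_set // inE => xm.
have [i Si fi] := fsurj _ (orb_Porb m0 xm).
have fix_ : f i x by rewrite fi; exact: orb_refl.
have iB : i \in B.
  apply: AB; split=> //; have [_ xp] := Porb_card (fP _ Si) fix_.
  by apply: leq_trans mn; apply: dvdn_leq => //; apply/(Per_dvdn _ xp).
rewrite (bigD1_seq i) //= big_seq_cond big1 ?addn0; first by rewrite mem_set.
move=> j /andP[jB ji]; rewrite memNset // => fjx; move/eqP: ji; apply.
apply: finj; rewrite ?inE //; first exact: BS.
exact: Porb_disjoint (fB _ jB) (fP _ Si) fjx fix_.
Qed.

(* Both sides have the logarithmic derivative [n |-> |Per_n|], up to any given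
   degree once the finite product contains all the short orbits. *)
Lemma zeta_prod :
  zeta phi = fps_prod S (fun i =>
    fps_inv (fps_sub fps_one (fps_X (set_card (f i))))).
Proof.
apply/esym/fps_prodE => n; have finA := finite_short_orbits n.
exists (fset_set [set i | S i /\ (set_card (f i) <= n)%N]); rewrite fset_setK //.
  by move=> i [].
move=> B AB BS; have [fP _ _] := f_bij.
have l0 i : i \in B -> (0 < set_card (f i))%N.
  by move=> iB; exact/Porb_card_gt0/fP/BS.
rewrite (eq_big_seq (fun i => fps_geom (set_card (f i)))); last first.
  by move=> i /l0 /fps_inv_geom.
pose F : fps := fun m =>
  if m == 0%N then 0 else (set_card (Per phi m))%:R / m%:R.
apply/esym; rewrite -[zeta phi]/(fps_exp F).
apply: (fps_theta_eq _ (fps_theta_exp (F := F) _) (fps_theta_prod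
  (L := fun i => fps_dlog_geom (set_card (f i))) _)) => //.
- by move=> i iB; rewrite fps_theta_geom // l0.
- case=> [|m] mn; rewrite /fps_theta /fps_dlog_geom /=.
    by rewrite mul0r big1.
  rewrite mulrCA divff ?pnatr_eq0 // mulr1 (@card_Per_sum n _ B) //.
  by rewrite natr_sum.
- rewrite fps_prod0 big1; first by rewrite /fps_exp big_ord1 /= /fps_one divr1.
  by move=> i _; rewrite /fps_geom dvdn0.
Qed.

End EulerProduct.
End PeriodicOrbits.

(** * Asymptotic points of a Smale space *)

Section Asymptotic.
Variables (R : realType) (X : metricType R) (phi : homeomorphism X X).

Lemma nbhs_mdistE (x : X) (P : set X) :
  nbhs x P <-> exists2 r : R, 0 < r & forall z, mdist x z < r -> P z.
Proof. exact: metricType_numDomainType.nbhs_mdistP. Qed.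

Lemma iter_continuous (n : nat) : continuous (iter n phi).
Proof.
elim: n => [|n IH] x; first exact: cvg_id.
by apply: continuous_comp; [exact: IH|exact: homeo_fun_continuous].
Qed.

Definition asymptotic (x y : X) := forall e : R, 0 < e ->
  exists N, forall n, (N <= n)%N -> mdist (iter n phi x) (iter n phi y) < e.

Lemma asymptotic_sym x y : asymptotic x y -> asymptotic y x.
Proof.
by move=> xy e /xy[N Nxy]; exists N => n /Nxy; rewrite metric_sym.
Qed.

Lemma asymptotic_trans y x z :
  asymptotic x y -> asymptotic y z -> asymptotic x z.
Proof.
move=> xy yz e e0; have e20 : 0 < e / 2 by rewrite divr_gt0.
have [[N Nxy] [M Myz]] := (xy _ e20, yz _ e20).
exists (maxn N M) => n; rewrite geq_max => /andP[/Nxy xyn /Myz yzn].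
by apply: le_lt_trans (metric_triangle _ (iter n phi y) _) _; lra.
Qed.

Lemma asymptotic_ziter (m : int) x y :
  asymptotic x y -> asymptotic (ziter phi m x) (ziter phi m y).
Proof.
move=> xy e /xy[N Nxy]; exists (N + `|m|)%N => n nN.
have E z : iter n phi (ziter phi m z) = iter (absz (n%:Z + m)) phi z.
  rewrite -[LHS]/(ziter phi n%:Z _) -ziterD.
  by rewrite -[RHS]/(ziter phi (absz (n%:Z + m))%:Z z) gez0_abs //; lia.
by rewrite !E; apply: Nxy; lia.
Qed.

(** At the times N p q both points have returned to their initial positions, so their distance would
    be smaller than itself if it were positive. *)
Lemma asymptotic_Per (p q : nat) x y : (0 < p)%N -> (0 < q)%N ->
  Per phi p x -> Per phi q y -> asymptotic x y -> x = y.
Proof.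
move=> p0 q0 xp yq xy; apply: mdist_positivity; apply/eqP.
rewrite eq_le mdist_ge0 andbT leNgt; apply/negP => /xy[N].
move=> /(_ (N * (p * q))%N); rewrite leq_pmulr ?muln_gt0 ?p0 // => /(_ isT).
have -> : iter (N * (p * q)) phi x = x.
  by rewrite (mulnC p) mulnA; exact: Per_mul.
by rewrite mulnA (Per_mul (N * p) yq) ltxx.
Qed.

End Asymptotic.

Lemma expr_small (R : realType) (l C e : R) : 0 < l -> l < 1 -> 0 < e ->
  exists N, forall n, (N <= n)%N -> l ^+ n * C < e.
Proof.
move=> l0 l1 e0.
have l1' : `|l| < 1 by rewrite gtr0_norm.
have /cvgrPdist_lt := @cvg_geometric _ C _ l1'.
move=> /(_ _ e0)[N _ NP]; exists N => n /NP /=.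
rewrite sub0r normrN mulrC => H; exact: le_lt_trans (ler_norm _) H.
Qed.

(** * Contraction, expansiveness and periodic limits in a Smale space *)

Section SmaleSpaces.
Variables (R : realType) (X : metricType R) (S : smaleSpace X).
Local Notation lam := (lam0 S).
Local Notation eps := (eps0 S).

(** As [x] lies in its own local stable set, the contraction applies to the pair; the images then
    remain within [eps], where the bracket commutes with the map. *)
Lemma Gs0_smap x y : Gs0 S (x, y) ->
  Gs0 S (S x, S y) /\ mdist (S x) (S y) <= lam * mdist x y.
Proof.
move=> [/= yx dxy]; have e0 := eps0_gt0 S.
have xx : stable_set (br S) x eps x by split; rewrite ?brxx ?mdistxx.
have le : mdist (S x) (S y) <= lam * mdist x y.
  exact: (smap_contract e0 (lexx _) xx).
have lt : mdist (S x) (S y) < eps.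
  apply: le_lt_trans le _; apply: le_lt_trans dxy.
  by rewrite ler_piMl ?mdist_ge0 ?(ltW (lam0_lt1 S)).
by split=> //; split=> //=; rewrite br_smap ?yx // metric_sym.
Qed.

Lemma Gs0_iter x y n : Gs0 S (x, y) ->
  Gs0 S (iter n S x, iter n S y) /\
  mdist (iter n S x) (iter n S y) <= lam ^+ n * eps.
Proof.
move=> xy; elim: n => [|n [IH1 IH2]].
  by rewrite expr0 mul1r; split=> //; case: xy => _ /= /ltW.
have [? le] := Gs0_smap IH1; split=> //=.
by apply: le_trans le _; rewrite exprS -mulrA ler_pM2l ?lam0_gt0.
Qed.

Lemma Gs0_asymptotic x y : Gs0 S (x, y) -> asymptotic S x y.
Proof.
move=> xy e /(expr_small eps (lam0_gt0 S) (lam0_lt1 S))[N NP]; exists N => n /NP.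
by apply: le_lt_trans; have [] := Gs0_iter n xy.
Qed.

(** Cancels the waiting time [m], so that the auxiliary functions k and m of the orbit equivalence
    disappear and only the cocycle exponents remain. *)
Lemma Gs0_ziter_asymptotic (m n : int) x y :
  Gs0 S (ziter S (m + n) x, ziter S m y) -> asymptotic S (ziter S n x) y.
Proof.
move=> /Gs0_asymptotic/(asymptotic_ziter (- m)).
by rewrite -!ziterD addNr addKr.
Qed.

(** Continuity of the bracket at a diagonal point (a, a), where its value is [a], gives the bounds
    near [a]; compactness makes the radius uniform. *)
Lemma br_near : exists2 d : R, 0 < d & forall x y, mdist x y < d ->
  [/\ mdist x y < eps, mdist x (br S y x) < eps & mdist y (br S y x) < eps].
Proof.
have e0 := eps0_gt0 S.
pose P (d : R) (x : X) := forall y, mdist x y < d ->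
  [/\ mdist x y < eps, mdist x (br S y x) < eps & mdist y (br S y x) < eps].
have /compact_near_coveringP /(_ _ (0^'+ : set_system R) P _) := smale_compact S.
case=> [a _|d /= d0 dP]; last first.
  exists (d / 2); first by rewrite divr_gt0.
  move=> x y; apply: (dP (d / 2)) => //=; last by rewrite divr_gt0.
  by rewrite sub0r normrN ltr_norml; lra.
have /subspace_continuousP /(_ (a, a)) := br_continuous (s := S).
rewrite [_ (a, a)]/= mdistxx => /(_ e0).
move=> /metricType_numDomainType.cvgrPdist_lt /(_ (eps / 4)).
rewrite divr_gt0 // => /(_ isT); rewrite /from_subspace /= brxx.
move=> [[U V] /= [/nbhs_mdistE[r r0 rU] /nbhs_mdistE[s s0 sV]] UV].
(* Points within [t] of [a] have their bracket within [eps / 4] of [a], so the triangle inequality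
   through [a] bounds all three distances. *)
pose t := Num.min (Num.min r s) (eps / 4).
have t0 : 0 < t by rewrite !lt_min r0 s0 divr_gt0.
near=> x d => y /= xy.
have dt : d < t / 2 by near: d; apply: nbhs_right_lt; rewrite divr_gt0.
have ax : mdist a x < t / 2.
  by near: x; apply/nbhs_mdistE; exists (t / 2) => //; rewrite divr_gt0.
have ay : mdist a y < t.
  have := metric_triangle a x y; lra.
have ax' : mdist a x < t by lra.
move: (ax') (ay); rewrite /t !lt_min => /andP[/andP[xr xs] xe] /andP[/andP[yr ys] ye].
have xye : mdist x y < eps by have := metric_triangle x a y; rewrite (metric_sym x a); lra.
have /= := UV (y, x) (conj (rU _ yr) (sV _ xs)); rewrite metric_sym => /(_ xye) ab.
split=> //.
  by have := metric_triangle x a (br S y x); rewrite (metric_sym x a); lra.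
by have := metric_triangle y a (br S y x); rewrite (metric_sym y a); lra.
Unshelve. all: by end_near. Qed.

(* Local expansiveness in the future: the points [br y_n x_n] lie on the
   unstable sets of the [y_n] and stay within [eps] of them, hence coincide with
   the [y_n] by backward contraction. *)
Lemma Gs0_shadow : exists2 d : R, 0 < d &
  forall x y, (forall n, mdist (iter n S x) (iter n S y) < d) -> Gs0 S (x, y).
Proof.
have [d d0 dP] := br_near; exists d => // x y xy.
have e0 := eps0_gt0 S.
pose w n := br S (iter n S y) (iter n S x).
have wS n : w n.+1 = S (w n).
  have [xye _ _] := dP _ _ (xy n); have [xye' _ _] := dP _ _ (xy n.+1).
  by rewrite /w /= br_smap // metric_sym.
have unst n : unstable_set (br S) (iter n S y) eps (w n).
  have [xye xw yw] := dP _ _ (xy n); split=> //.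
  (* With y' and x' the n-th iterates, the bracket identity [y',[y',x']] = [y',x'] says that [w n]
     is in the unstable set of y'. *)
  have [] := @br_assoc _ _ S (iter n S y) (iter n S y) (iter n S x).
  - by rewrite mdistxx.
  - by rewrite metric_sym.
  - by rewrite metric_sym.
  - by rewrite brxx metric_sym.
  - exact: yw.
  - by [].
have contr n : mdist (iter n S y) (w n) <= lam * mdist (iter n.+1 S y) (w n.+1).
  have := sinv_contract e0 (lexx _) _ (unst n.+1).
  move=> /(_ (iter n.+1 S y)); rewrite wS !homeo_funK; apply.
  by split; rewrite ?brxx ?mdistxx.
have small n : mdist y (w 0%N) <= lam ^+ n * eps.
  have : mdist y (w 0%N) <= lam ^+ n * mdist (iter n S y) (w n).
    elim: n => [|n IH]; first by rewrite mul1r.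
    apply: le_trans IH _; rewrite exprSr -mulrA ler_pM2l ?exprn_gt0 ?lam0_gt0 //.
  move/le_trans; apply; rewrite ler_pM2l ?exprn_gt0 ?lam0_gt0 //.
  by have [_ /ltW] := unst n.
have E : w 0%N = y.
  apply/esym/mdist_positivity/eqP; rewrite eq_le mdist_ge0 andbT leNgt.
  apply/negP => /(expr_small eps (lam0_gt0 S) (lam0_lt1 S))[N /(_ N (leqnn _))].
  by rewrite ltNge small.
(* The equality [w 0 = y] is [y, x] = y, which is membership in the stable set of [x]. *)
have [xye _ _] := dP _ _ (xy 0%N); split=> //=.
Qed.

(** The converse of [Gs0_asymptotic] up to a time shift: a tail of the two orbits stays within the
    constant of [Gs0_shadow]. *)
Lemma asymptotic_Gs0 x y : asymptotic S x y ->
  exists N, Gs0 S (iter N S x, iter N S y).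
Proof.
have [d d0 dP] := Gs0_shadow; move=> /(_ _ d0)[N NP]; exists N.
by apply: dP => n; rewrite -!iterD; apply: NP; rewrite leq_addl.
Qed.

(** Finitely many balls for the distance maximised over [n] iterates cover the space. Two points of
    period [n] in one ball stay close at all times, so they are asymptotic, hence equal. *)
Lemma finite_Per n : (0 < n)%N -> finite_set (Per S n).
Proof.
move=> n0; have [d d0 dP] := Gs0_shadow.
pose U x : set X := [set z | forall i : 'I_n, mdist (iter i S x) (iter i S z) < d / 2].
have nU x : nbhs x (U x).
  apply: filter_forall => i.
  have /metricType_numDomainType.cvgrPdist_lt := @iter_continuous _ _ S i x.
  by apply; rewrite divr_gt0.
(* The filter of sets containing some finite set; near-covering along it yields a finite
   subcover. *)
pose F := filter_from finite_set (fun D : set X => [set B : set X | D `<=` B]).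
have FF : Filter F.
  apply: filter_from_filter; first by exists set0.
  move=> D D' finD finD'; exists (D `|` D'); first by rewrite finite_setU.
  by move=> B DB; split=> x Dx; apply: DB; [left|right].
have /compact_near_coveringP := smale_compact S.
move=> /(_ _ F (fun (B : set X) x => exists2 b, B b & U b x)) [|D finD DP].
- move=> x _; exists (U x, [set B | [set x] `<=` B]) => /=.
    by split; [exact: nU|exists [set x]].
  by move=> [z B] /= [Uz xB]; exists x => //; exact: xB.
apply: (@sub_finite_set _ _ (\bigcup_(x in D) (U x `&` Per S n))).
  by move=> z zn; have [x xD xz] := DP D (@subset_refl _ _) z I; exists x.
apply: bigcup_finite => // x _.
have sub z z' : (U x `&` Per S n) z -> (U x `&` Per S n) z' -> z = z'.
  move=> [Uz zn] [Uz' zn'].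
  apply: (asymptotic_Per n0 n0 zn zn'); apply: Gs0_asymptotic; apply: dP => k.
  have E t : Per S n t -> iter k S t = iter (k %% n) S t.
    by move=> tn; rewrite {1}(divn_eq k n) addnC iterD (Per_mul _ tn).
  rewrite (E z zn) (E z' zn'); have kn : (k %% n < n)%N by rewrite ltn_pmod.
  have := Uz (Ordinal kn); have := Uz' (Ordinal kn); rewrite /=.
  have := metric_triangle (iter (k %% n) S z) (iter (k %% n) S x) (iter (k %% n) S z').
  by rewrite (metric_sym _ (iter _ S x)); lra.
have [->|/set0P[z0 z0P]] := eqVneq (U x `&` Per S n) set0; first by [].
by apply: (@sub_finite_set _ _ [set z0]) => // z zP; exact: sub.
Qed.

(** After a time [N], z and its q-th iterate are locally stably equivalent, so the gaps between
    successive q-step iterates decay geometrically: the sequence is Cauchy. *)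
Lemma asymptotic_limit z q : (0 < q)%N -> asymptotic S z (iter q S z) ->
  exists y, [/\ (fun k => iter (q * k) S z) @ \oo --> y, Per S q y &
    asymptotic S z y].
Proof.
move=> q0 /asymptotic_Gs0[N zN].
have [[l0 l1] e0] := (lam0_gt0 S, lam0_lt1 S, eps0_gt0 S).
(* The sum of the geometric series of gaps; the identity [CE] is the induction step, with lam^q
   bounded by lam as [q] is positive. *)
pose C := eps / (1 - lam).
have C0 : 0 < C by rewrite divr_gt0 // subr_gt0.
have CE : eps + lam * C = C by rewrite /C; field; rewrite subr_eq0 gt_eqF.
have geo k n : mdist (iter (n + N) S z) (iter (n + N + q * k) S z) <= lam ^+ n * C.
  elim: k n => [|k IH] n; first by rewrite muln0 addn0 mdistxx mulr_ge0 ?exprn_ge0 ?ltW.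
  apply: le_trans (metric_triangle _ (iter (n + N + q) S z) _) _.
  have [_] := Gs0_iter n zN; rewrite -!iterD -addnA => le1.
  have := IH (n + q)%N; rewrite mulnS.
  have -> : (n + q + N = n + (N + q))%N by lia.
  have -> : (n + (N + q) + q * k = n + N + (q + q * k))%N by lia.
  move=> le2; apply: le_trans (lerD le1 le2) _.
  rewrite exprD -mulrA -mulrDr ler_pM2l ?exprn_gt0 // -[leRHS]CE lerD2l.
  rewrite ler_pM2r // -[leRHS]expr1 ler_wiXn2l //; exact: ltW.
have small e : 0 < e -> exists M, forall n k, (M <= n)%N ->
    mdist (iter n S z) (iter (n + q * k) S z) < e.
  move=> /(expr_small C l0 l1)[M MP]; exists (M + N)%N => n k Mn.
  have := geo k (n - N)%N; rewrite subnK; last lia.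
  by move/le_lt_trans; apply; apply: MP; lia.
pose u k := iter (q * k) S z.
(* Compactness gives a cluster point, which the Cauchy estimate [small] upgrades to a limit. *)
have [|y [_ yu]] := smale_compact S (F := u @ \oo); first exact: filterT.
have uy : u @ \oo --> y.
  apply/metricType_numDomainType.cvgrPdist_lt => e e1.
  have e2 : 0 < e / 2 by rewrite divr_gt0.
  have [M MP] := small _ e2.
  have uM : (u @ \oo) [set u k | k in [set k | (M <= k)%N]].
    by exists M => // k Mk; exists k.
  have yB : nbhs y [set z | mdist y z < e / 2] by apply/nbhs_mdistE; exists (e / 2).
  have [_ [[j Mj <-] /= yj]] := yu _ _ uM yB.
  exists j => // k /= jk; have := MP (q * j)%N (k - j)%N.
  rewrite -mulnDr subnKC // (leq_trans Mj) ?leq_pmull // => /(_ isT).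
  by have := metric_triangle y (u j) (u k); rewrite /u; lra.
exists y; split=> //.
  apply: (@cvg_unique _ (@metric_hausdorff _ X) ((iter q S \o u) @ \oo)).
    by apply: cvg_comp uy _; exact: iter_continuous.
  (* Applying the q-th iterate shifts the sequence by one, so its limit is fixed. *)
  have -> : iter q S \o u = u \o succn.
    by apply/funext => n; rewrite /u /= mulnS iterD.
  by move=> P /uy[M _ MP]; exists M => // n /= Mn; apply: MP; exact: leqW.
move=> e e1; have e2 : 0 < e / 2 by rewrite divr_gt0.
have [M MP] := small _ e2; exists M => n Mn.
have /metricType_numDomainType.cvgrPdist_lt /(_ _ e2) [k _ /(_ k (leqnn k)) /=] :
    iter n S \o u @ \oo --> iter n S y.
  by apply: cvg_comp uy _; exact: iter_continuous.
have := MP n k Mn; rewrite /u iterD (metric_sym (iter n S y)).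
by have := metric_triangle (iter n S z) (iter n S (u k)) (iter n S y); rewrite /u; lra.
Qed.

End SmaleSpaces.

(** * The bijection of periodic orbits *)

Section OrbitEquivalence.
Variables (R : realType) (X Y : metricType R).
Variables (SX : smaleSpace X) (SY : smaleSpace Y) (h : homeomorphism X Y).
Variables (c1 : X -> int) (c2 : Y -> int) (d1 : X * X -> int) (d2 : Y * Y -> int).
Hypothesis coe : half_stably_coe SX SY h c1 c2 d1 d2.

Lemma asymptotic_csum n x :
  asymptotic SY (ziter SY (csum SX c1 n x) (h x)) (h (ziter SX n x)).
Proof.
by have [k _ /(_ x) kP] := coe_orbit coe n; exact: Gs0_ziter_asymptotic kP.
Qed.

Lemma asymptotic_stable x z : asymptotic SX x z ->
  asymptotic SY (ziter SY (d1 (x, z)) (h x)) (h z).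
Proof.
move=> /asymptotic_Gs0[N xz]; have [m _ mP] := coe_stable coe.
apply: (@Gs0_ziter_asymptotic _ _ _ (m (x, z))%:Z); apply: mP.
by exists N.
Qed.
End OrbitEquivalence.

Section Xi.
Variables (R : realType) (X Y : metricType R).
Variables (SX : smaleSpace X) (SY : smaleSpace Y) (h : homeomorphism X Y).
Variables (c1 : X -> int) (c2 : Y -> int) (d1 : X * X -> int) (d2 : Y * Y -> int).
Hypotheses (coe : half_stably_coe SX SY h c1 c2 d1 d2)
  (coe' : half_stably_coe SY SX (homeo_sym h) c2 c1 d2 d1).
Local Notation eta1 := (eta SX SY h c1).
Local Notation xi1 := (xi SX SY h c1).

(* Condition (v) at n = p: a periodic point along which [c1] sums to zero would
   have a vanishing period, since [d2] vanishes on the diagonal. *)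
Lemma csum_period_neq0 p x : (0 < p)%N -> Per SX p x ->
  (0 < absz (csum SX c1 p x))%N.
Proof.
move=> p0 xp; rewrite absz_gt0; apply/eqP => c0.
have := coe_c_inverse coe x p; rewrite c0 /= big_ord0 add0r [iter p SX x]xp.
have [_ coc] := coe_d_cocycle coe'.
have hx : Gs SY (h x, h x).
  by exists 0%N => //; split; rewrite /= ?brxx ?mdistxx ?eps0_gt0.
have := coc _ _ _ hx hx; lia.
Qed.

Lemma etaP n x : (0 < n)%N -> Per SX n x -> exists q, [/\ (0 < q)%N,
  Per SY q (eta1 x) & asymptotic SY (h x) (eta1 x)].
Proof.
move=> n0 xn; have [p0 xp _] := least_periodP n0 xn.
set p := least_period _ _ in p0 xp.
have q0 := csum_period_neq0 p0 xp.
have hxq : asymptotic SY (h x) (iter (absz (csum SX c1 p x)) SY (h x)).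
  have := asymptotic_csum coe p x; rewrite [ziter SX p x]xp.
  (* For a negative sum -(q+1), both sides are moved forward by q+1 steps, so only the absolute
     value matters. *)
  case: (csum SX c1 p x) => q; first exact: asymptotic_sym.
  move=> /(asymptotic_ziter q.+1); rewrite -ziterD.
  by have -> : q.+1%:Z + Negz q = 0 by lia.
have [y [uy yq hxy]] := asymptotic_limit q0 hxq.
have -> : eta1 x = y.
  apply: xget_unique => // z uz.
  exact: (@cvg_unique _ (@metric_hausdorff _ Y) _ (fmap_proper_filter _ _) _ _ uz uy).
by exists (absz (csum SX c1 p x)).
Qed.

(** Characterises [eta] without limits: asymptotic periodic points coincide. *)
Lemma eta_unique n x q y : (0 < n)%N -> Per SX n x -> (0 < q)%N ->
  Per SY q y -> asymptotic SY (h x) y -> eta1 x = y.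
Proof.
move=> n0 xn q0 yq hxy; have [r [r0 er hxe]] := etaP n0 xn.
apply: asymptotic_Per r0 q0 er yq _.
exact: asymptotic_trans (asymptotic_sym hxe) hxy.
Qed.

Lemma xi_orb n x : (0 < n)%N -> Per SX n x ->
  xi1 (orb SX x) = orb SY (eta1 x).
Proof.
move=> n0 xn; apply/seteqP; split; last first.
  by move=> y xy; exists x => //; exact: orb_refl.
have [q [q0 eq hxe]] := etaP n0 xn.
(* Moving [x] by [m] steps moves [eta] by [csum SX c1 m x] steps: the moved point is periodic and
   asymptotic to the image of the m-th iterate. The union defining [xi] is thus a single orbit. *)
move=> y [_ [m _ <-]]; rewrite (eta_unique n0 _ q0 _ _
  (y := ziter SY (csum SX c1 m x) (eta1 x))).
- by rewrite (@orb_eq _ _ (eta1 x)) //; exists (csum SX c1 m x).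
- exact: Per_ziter.
- exact: Per_ziter.
- apply: asymptotic_trans (asymptotic_sym (asymptotic_csum coe m x)) _.
  exact: asymptotic_ziter.
Qed.

Lemma xi_Porb g : Porb SX g -> Porb SY (xi1 g).
Proof.
move=> [x [n n0 [xn ->]]]; rewrite (xi_orb n0 xn).
by have [q [q0 eq _]] := etaP n0 xn; exact: orb_Porb eq.
Qed.
End Xi.

Lemma xiK (R : realType) (X Y : metricType R) (SX : smaleSpace X)
    (SY : smaleSpace Y) (h : homeomorphism X Y) (c1 : X -> int) (c2 : Y -> int)
    (d1 : X * X -> int) (d2 : Y * Y -> int) :
  half_stably_coe SX SY h c1 c2 d1 d2 ->
  half_stably_coe SY SX (homeo_sym h) c2 c1 d2 d1 ->
  forall g, Porb SX g -> xi SY SX (homeo_sym h) c2 (xi SX SY h c1 g) = g.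
Proof.
move=> coe coe' g [x [n n0 [xn ->]]]; rewrite (xi_orb coe coe' n0 xn).
(* [homeo_sym] is involutive by computation once [h] is an explicit record. *)
have coe'' : half_stably_coe SX SY (homeo_sym (homeo_sym h)) c1 c2 d1 d2.
  by case: h coe {coe'}.
have [q [q0 yq hxy]] := etaP coe coe' n0 xn.
rewrite (xi_orb coe' coe'' q0 yq).
(* The inverse of [h] sends [eta x] to a point asymptotic to a [d2]-shift of [x]; this shift is
   periodic, so it is the value of the reverse [eta] at [eta x]. *)
have := asymptotic_stable coe' hxy; rewrite [homeo_sym h (h x)]homeo_funK => xy.
rewrite (eta_unique coe' coe'' q0 yq n0 _ (asymptotic_sym xy)).
  by rewrite (@orb_eq _ _ x) //; exists (d2 (h x, eta SX SY h c1 x)).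
exact: Per_ziter.
Qed.

Lemma xi_bij (R : realType) (X Y : metricType R) (SX : smaleSpace X)
    (SY : smaleSpace Y) (h : homeomorphism X Y) (c1 : X -> int) (c2 : Y -> int)
    (d1 : X * X -> int) (d2 : Y * Y -> int) :
  stably_coe SX SY h c1 c2 d1 d2 ->
  set_bij (Porb SX) (Porb SY) (xi SX SY h c1) /\
  set_bij (Porb SY) (Porb SX) (xi SY SX (homeo_sym h) c2).
Proof.
move=> [coe coe'].
have coe'' : half_stably_coe SX SY (homeo_sym (homeo_sym h)) c1 c2 d1 d2.
  by case: h coe {coe'}.
have xiKX := xiK coe coe'.
have xiKY g : Porb SY g -> xi SX SY h c1 (xi SY SX (homeo_sym h) c2 g) = g.
  by have := xiK coe' coe'' (g := g); case: h {coe coe' coe'' xiKX}.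
have xiX := xi_Porb coe coe'; have xiY := xi_Porb coe' coe''.
split; split.
- exact: xiX.
- by move=> g g' /set_mem gP /set_mem gP' E; rewrite -(xiKX _ gP) E xiKX.
- by move=> g gP; exists (xi SY SX (homeo_sym h) c2 g); [exact: xiY|exact: xiKY].
- exact: xiY.
- by move=> g g' /set_mem gP /set_mem gP' E; rewrite -(xiKY _ gP) E xiKY.
- by move=> g gP; exists (xi SX SY h c1 g); [exact: xiX|exact: xiKX].
Qed.

Theorem theorem4p9 (R : realType) (X Y : metricType R)
    (SX : smaleSpace X) (SY : smaleSpace Y)
    (irrX : irreducible SX) (irrY : irreducible SY)
    (infX : infinite_set [set: X]) (infY : infinite_set [set: Y])
    (h : homeomorphism X Y) (c1 : X -> int) (c2 : Y -> int)
    (d1 : X * X -> int) (d2 : Y * Y -> int)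
    (coe : stably_coe SX SY h c1 c2 d1 d2) :
  zeta SX = zeta_xi SY SX (homeo_sym h) c2 /\
  zeta SY = zeta_xi SX SY h c1.
Proof.
have [bijX bijY] := xi_bij coe.
(* [zeta_prod] is used with the orbits of the other system as indices and [xi] as the bijection. *)
by split; apply: zeta_prod => //; exact: finite_Per.
Qed.
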